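(* Let $\cong$ be a congruence on LTSs such that $L \equiv L'$ (bisimilarity) implies $L \cong L'$ for all LTSs $L, L'$. If $\cong$ does not preserve the alphabet (i.e. there exist LTSs $L \cong L'$ with $\Sigma(L) \neq \Sigma(L')$), then $L \cong L'$ holds for every pair of LTSs $L, L'$.
   Context: An LTS is a tuple $L=(S,\Sigma,\Delta,\hat s)$ with a set of states $S$, an alphabet $\Sigma$ (possibly infinite) with $\tau\notin\Sigma$ ($\tau$ is a reserved invisible action), transitions $\Delta\subseteq S\times(\Sigma\cup\{\tau\})\times S$, and initial state $\hat s\in S$; write $\Sigma(L)$ for its alphabet. Operators: for $a\neq\tau$, the action prefix $a.L$ has states $S\cup\{\hat s'\}$ ($\hat s'$ fresh), alphabet $\Sigma\cup\{a\}$, transitions $\Delta\cup\{(\hat s',a,\hat s)\}$, initial state $\hat s'$. Hiding $L\setminus A$ has the same states and initial state, alphabet $\Sigma\setminus A$, and transitions $(s,a,s')$ such that for some $b$, $(s,b,s')\in\Delta$ and either $a=b\notin A$ or ($a=\tau$ and $b\in A$). Relational renaming: for a set $\Phi$ of pairs with $\tau$ neither in its domain $\mathcal D(\Phi)$ nor range, let $\Phi(a,b)$ mean $(a,b)\in\Phi$ or $a=b\notin\mathcal D(\Phi)$; $L\Phi$ has the same states and initial state, alphabet $\{b\mid\exists a\in\Sigma:\Phi(a,b)\}$ and transitions $\{(s,b,s')\mid\exists a:(s,a,s')\in\Delta\wedge\Phi(a,b)\}$. Parallel composition $L_1\| L_2$ has states $S_1\times S_2$, alphabet $\Sigma_1\cup\Sigma_2$,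 initial state $(\hat s_1,\hat s_2)$, and a transition $((s_1,s_2),a,(s_1',s_2'))$ iff (i) $a\notin\Sigma_2$, $(s_1,a,s_1')\in\Delta_1$, $s_2'=s_2$; or (ii) $a\notin\Sigma_1$, $(s_2,a,s_2')\in\Delta_2$, $s_1'=s_1$; or (iii) $a\in\Sigma_1\cap\Sigma_2$, $(s_1,a,s_1')\in\Delta_1$ and $(s_2,a,s_2')\in\Delta_2$. A congruence is an equivalence $\cong$ on LTSs such that $L\cong L'$ implies $a.L\cong a.L'$, $L\setminus A\cong L'\setminus A$, $L\Phi\cong L'\Phi$, $L\|L''\cong L'\|L''$ and $L''\|L\cong L''\|L'$ for all admissible $a,A,\Phi,L''$. Bisimilarity: $L_1\equiv L_2$ iff $\Sigma_1=\Sigma_2$ and there is a relation $\sim\subseteq S_1\times S_2$ with $\hat s_1\sim\hat s_2$ such that whenever $s_1\sim s_2$ and $a\in\Sigma\cup\{\tau\}$: each $(s_1,a,s_1')\in\Delta_1$ is matched by some $(s_2,a,s')\in\Delta_2$ with $s_1'\sim s'$, and each $(s_2,a,s_2')\in\Delta_2$ is matched by some $(s_1,a,s')\in\Delta_1$ with $s'\sim s_2'$. An equivalence $\cong$ preserves a function $X$ on LTSs if $L\cong L'$ implies $X(L)=X(L')$. *)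

(* Defs.v *)
From mathcomp Require Import all_boot.
From mathcomp Require Import boolp classical_sets.
From Stdlib Require Import RelationClasses.

Set Implicit Arguments.
Unset Strict Implicit.
Unset Printing Implicit Defensive.

Local Open Scope classical_set_scope.

(* [Act] is the universe from which visible actions are drawn.  A transition
   label is an element of [option Act], with [None] as the invisible action;
   hence alphabets, hiding sets and renamings, which are sets over [Act],
   cannot mention the invisible action. *)
Notation tau := None (only parsing).

Definition vis_tau (Act : Type) (A : set Act) : set (option Act) :=
  tau |` (Some @` A).

Record lts (Act : Type) : Type := LTS {
  state : Type;
  alphabet : set Act;
  trans : state -> option Act -> state -> Prop;
  init : state;
  trans_label : forall s x s', trans s x s' -> vis_tau alphabet x
}.

Section Operators.
Context {Act : Type}.
Implicit Types (L : lts Act) (a b : Act) (x y : option Act).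

(* The states of [a.L] are [option (state L)], the fresh one being [None]. *)
Inductive prefix_trans a L :
    option (state L) -> option Act -> option (state L) -> Prop :=
| prefix_first : prefix_trans a None (Some a) (Some (init L))
| prefix_later s x s' : trans s x s' -> prefix_trans a (Some s) x (Some s').

Lemma prefix_label a L s x s' :
  @prefix_trans a L s x s' -> vis_tau (alphabet L `|` [set a]) x.
Proof.
case=> [|{}s {}x {}s' /trans_label [->|[c Lc <-]]].
- by right; exists a => //; right.
- by left.
- by right; exists c => //; left.
Qed.

Definition prefix a L : lts Act := LTS None (@prefix_label a L).

Definition hide_trans L (A : set Act) (s : state L) x (s' : state L) : Prop :=
  exists y, trans s y s' /\
    ((x = y /\ ~ (Some @` A) y) \/ (x = tau /\ (Some @` A) y)).

Lemma hide_label L A s x s' :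
  @hide_trans L A s x s' -> vis_tau (alphabet L `\` A) x.
Proof.
case=> y [/trans_label Ly [[-> nAy]|[-> _]]]; last by left.
case: Ly nAy => [->|[c Lc <-]] nAc; first by left.
by right; exists c => //; split=> // Ac; apply: nAc; exists c.
Qed.

Definition hide L A : lts Act := LTS (init L) (@hide_label L A).

Definition ren (Phi : set (Act * Act)) a b : Prop :=
  Phi (a, b) \/ (a = b /\ ~ Phi.`1 a).

(* [ren] extended to labels: the invisible action is outside both the domain
   and the range of [Phi], so it is related to itself and nothing else. *)
Definition ren_label (Phi : set (Act * Act)) x y : Prop :=
  match x, y with
  | Some a, Some b => ren Phi a b
  | None, None => True
  | _, _ => False
  end.

Definition rename_trans L Phi (s : state L) y (s' : state L) : Prop :=
  exists x, trans s x s' /\ ren_label Phi x y.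

Lemma rename_trans_label L Phi s y s' :
  @rename_trans L Phi s y s' ->
  vis_tau [set b | exists2 a, alphabet L a & ren Phi a b] y.
Proof.
case=> x [/trans_label Lx]; case: y => [b|]; last by left.
case: Lx => [->|[a La <-]] //= r.
by right; exists b => //; exists a.
Qed.

Definition rename L Phi : lts Act := LTS (init L) (@rename_trans_label L Phi).

Definition par_trans L1 L2 (s : state L1 * state L2) x
    (s' : state L1 * state L2) : Prop :=
  [\/ [/\ ~ (Some @` alphabet L2) x, trans s.1 x s'.1 & s'.2 = s.2],
      [/\ ~ (Some @` alphabet L1) x, trans s.2 x s'.2 & s'.1 = s.1]
    | [/\ (Some @` (alphabet L1 `&` alphabet L2)) x,
          trans s.1 x s'.1 & trans s.2 x s'.2]].

Lemma par_label L1 L2 s x s' :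
  @par_trans L1 L2 s x s' -> vis_tau (alphabet L1 `|` alphabet L2) x.
Proof.
case=> [[_ /trans_label Lx _]|[_ /trans_label Lx _]|[_ /trans_label Lx _]];
  case: Lx => [->|[c Lc <-]]; try (by left); right; exists c => //.
- by left.
- by right.
- by left.
Qed.

Definition par L1 L2 : lts Act := LTS (init L1, init L2) (@par_label L1 L2).

Definition bisimilar L1 L2 : Prop :=
  alphabet L1 = alphabet L2 /\
  exists sim : state L1 -> state L2 -> Prop,
    sim (init L1) (init L2) /\
    forall s1 s2 x, sim s1 s2 -> vis_tau (alphabet L1) x ->
      (forall s1', trans s1 x s1' -> exists2 s', trans s2 x s' & sim s1' s') /\
      (forall s2', trans s2 x s2' -> exists2 s', trans s1 x s' & sim s' s2').

Record congruence (R : lts Act -> lts Act -> Prop) : Prop := Congruence {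
  cong_equiv : Equivalence R;
  cong_prefix : forall a L L', R L L' -> R (prefix a L) (prefix a L');
  cong_hide : forall A L L', R L L' -> R (hide L A) (hide L' A);
  cong_rename : forall Phi L L', R L L' -> R (rename L Phi) (rename L' Phi);
  cong_parl : forall L'' L L', R L L' -> R (par L L'') (par L' L'');
  cong_parr : forall L'' L L', R L L' -> R (par L'' L) (par L'' L')
}.

Definition preserves (R : lts Act -> lts Act -> Prop) (T : Type)
    (X : lts Act -> T) : Prop :=
  forall L L', R L L' -> X L = X L'.

End Operators.

(* Main.v *)
From mathcomp Require Import all_boot.
From mathcomp Require Import boolp classical_sets.
From Stdlib Require Import RelationClasses.
Require Import Defs.

Set Implicit Arguments.
Unset Strict Implicit.
Unset Printing Implicit Defensive.

Local Open Scope classical_set_scope.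

(** Write [stop A] for the transitionless LTS with alphabet [A].  If [L] and
    [L'] are congruent and [a] is in the alphabet of [L] only, then blocking
    everything by [(b.L) || stop {b}] with [b <> a], and hiding all actions but
    [a], yields [stop {a}] congruent to [stop set0]; renaming [a] to all of [A]
    makes every [stop A] congruent to [stop set0].  As [L || stop set0] is
    bisimilar to [L], visible actions can therefore be blocked at will.  For
    the invisible ones, block all visible actions of [L] and regard what
    remains as an LTS over [{c}] in which [c] has been hidden; before the
    hiding, [c] can be blocked as well. *)

Section Stop.
Context {Act : Type}.
Implicit Types (L : lts Act) (A B : set Act) (c : Act).

Definition stop A : lts Act :=
  @LTS Act unit A (fun _ _ _ => False) tt (fun _ _ _ => False_ind _).

(** Only the initial state must be stuck: all other states are then unreachable, so relating the
    initial states suffices. *)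
Lemma bisimilar_stop L A :
  alphabet L = A -> (forall x s, ~ trans (init L) x s) -> bisimilar L (stop A).
Proof.
move=> LA L0; split=> //; exists (fun s _ => s = init L); split=> // s u x -> _.
by split=> [s' /L0|s' []].
Qed.

Lemma bisimilar_par_stop0 L : bisimilar (par L (stop set0)) L.
Proof.
split; first exact: setU0.
exists (fun p s => p.1 = s); split=> // -[s1 []] s2 x /= <- _; split.
- move=> [s' []] [[_ t _]|[_ []]|[_ _ []]]; exact: ex_intro2 t _.
- move=> s' t; exists (s', tt) => //; apply: Or31; split=> //.
  by case=> ? [].
Qed.

Lemma par_stop_trans L A (s s' : state L) (u u' : unit) x :
  @par_trans Act L (stop A) (s, u) x (s', u') <->
  ~ (Some @` A) x /\ trans s x s'.
Proof.
split=> [[[nx t _]|[_ []]|[_ _ []]]|[nx t]] //; case: u u' => -[].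
exact: Or31.
Qed.

Lemma trans_tau_only L A (s s' : state L) x :
  alphabet L `<=` A -> ~ (Some @` A) x -> trans s x s' -> x = None.
Proof. by move=> LA nx /trans_label[//|[c /LA Ac cx]]; case: nx; exists c. Qed.

Definition reveal_trans L c (s : state L) (x : option Act) (s' : state L) :=
  x = Some c /\ trans s None s'.

Lemma reveal_label L c s x s' :
  @reveal_trans L c s x s' -> vis_tau [set c] x.
Proof. by case=> -> _; right; exists c. Qed.

Definition reveal L c : lts Act := LTS (init L) (@reveal_label L c).

Lemma hide_reveal_trans L c (s s' : state L) x :
  @hide_trans Act (reveal L c) [set c] s x s' <-> x = None /\ trans s None s'.
Proof.
split=> [[y [[-> t] [[_ nc]|[-> _]]]]|[-> t]] //; first by case: nc; exists c.
by exists (Some c); split; [split|right; split=> //; exists c].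
Qed.

(** Next to [stop setT] only invisible steps survive, and these are what [reveal] followed by hiding
    [c] keeps. Both alphabets become [setT]. *)
Lemma bisimilar_block_visible L c :
  bisimilar (par L (stop setT)) (par (hide (reveal L c) [set c]) (stop setT)).
Proof.
split; first by rewrite /= !setUT.
exists (fun p q => p.1 = q.1); split=> // -[s u] [s2 v] x /= <- _.
split=> -[s' w] /par_stop_trans[nx] => [t|/hide_reveal_trans[xN t]].
- exists (s', tt) => //; apply/par_stop_trans; split=> //.
  have xN := trans_tau_only (@subsetT _ _) nx t.
  by apply/hide_reveal_trans; rewrite -xN.
- by exists (s', tt) => //; apply/par_stop_trans; rewrite xN in nx *.
Qed.

End Stop.

Section Collapse.
Context {Act : Type} (R : lts Act -> lts Act -> Prop).
Hypothesis R_cong : congruence R.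
Hypothesis bisim_R : forall L L' : lts Act, bisimilar L L' -> R L L'.
Implicit Types (L : lts Act) (A : set Act) (a b c : Act).

#[local] Instance R_equiv : Equivalence R := cong_equiv R_cong.

Lemma R_stop1 L L' a b :
  a <> b -> R L L' -> alphabet L a -> ~ alphabet L' a ->
  R (stop [set a]) (stop set0).
Proof.
move=> ab LL' La nL'a.
(* The first step of [prefix b K] is blocked, so [F K] is stuck at its start; since [b] is not [a],
   its alphabet is [[set a]] or empty according to whether [K] has [a]. *)
pose F K := hide (par (prefix b K) (stop [set b])) (~` [set a]).
have FR : R (F L) (F L').
  exact/(cong_hide R_cong)/(cong_parl R_cong)/(cong_prefix R_cong).
have Fstop K A : (alphabet K `|` [set b] `|` [set b]) `\` ~` [set a] = A ->
    R (F K) (stop A).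
  move=> KA; apply: bisim_R; apply: bisimilar_stop; first exact: KA.
  move=> x [s u] [y [+ _]].
  move=> /par_stop_trans[nb t]; apply: nb.
  by inversion t; exists b.
transitivity (F L); first (symmetry; apply: Fstop).
- apply/seteqP; split=> x /=; rewrite notK; first by case.
  by move=> ->; split; [left; left|].
- transitivity (F L'); first by [].
  apply: Fstop; apply/seteqP; split=> x // [+ /contrapT xa].
  by rewrite xa => -[[]|] // /esym/ab.
Qed.

Lemma R_stop A a :
  R (stop [set a]) (stop set0) -> R (stop A) (stop set0).
Proof.
pose Phi := [set p : Act * Act | p.1 = a /\ A p.2] => Ra.
(* For empty [A] the domain of [Phi] is empty and renaming would keep [a]; an element [d] of [A]
   puts [a] in the domain. *)
have [->|/set0P[d Ad]] := eqVneq A set0; first reflexivity.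
have renR B C : [set y | exists2 x, B x & ren Phi x y] = C ->
    R (rename (stop B) Phi) (stop C).
  by move=> BC; apply: bisim_R; apply: bisimilar_stop => // x s [y []].
transitivity (rename (stop [set a]) Phi).
  symmetry; apply: renR; apply/seteqP; split=> y.
    by move=> [x ->] [[]//|[_]]; case; exists d.
  by move=> Ay; exists a => //; left.
transitivity (rename (stop set0) Phi); first exact: cong_rename.
by apply: renR; apply/seteqP; split=> y // [].
Qed.

Hypothesis R_stop0 : forall A, R (stop A) (stop set0).

Lemma R_block L A : R L (par L (stop A)).
Proof.
transitivity (par L (stop set0)).
  by symmetry; apply/bisim_R/bisimilar_par_stop0.
by apply: cong_parr => //; symmetry.
Qed.

(** Every step of [reveal L c] is labelled [c], so blocking [c] removes them all. *)
Lemma R_reveal L c : R (reveal L c) (stop set0).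
Proof.
transitivity (par (reveal L c) (stop [set c])); first exact: R_block.
transitivity (stop [set c]) => //; apply: bisim_R; apply: bisimilar_stop.
  exact: setUid.
by move=> x [s u] /par_stop_trans[nx [xc _]]; apply: nx; exists c.
Qed.

Lemma R_collapse L c : R L (stop set0).
Proof.
transitivity (par L (stop setT)); first exact: R_block.
transitivity (par (hide (reveal L c) [set c]) (stop setT)).
  exact/bisim_R/bisimilar_block_visible.
(* [R_block] in reverse: the blocking is lifted once the visible steps of [L] are gone. *)
transitivity (hide (reveal L c) [set c]); first by symmetry; apply: R_block.
transitivity (hide (stop set0) [set c]).
  by apply: cong_hide => //; apply: R_reveal.
by apply: bisim_R; apply: bisimilar_stop => [|x s [y []] //]; exact: set0D.
Qed.

End Collapse.

Theorem theorem4p1 (Act : Type) (two_actions : exists a b : Act, a <> b)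
    (R : lts Act -> lts Act -> Prop)
    (R_cong : congruence R)
    (bisim_R : forall L L' : lts Act, bisimilar L L' -> R L L')
    (R_not_alphabet : ~ preserves R (@alphabet Act)) :
  forall L L' : lts Act, R L L'.
Proof.
have R_equiv := cong_equiv R_cong.
have other a : exists b : Act, a <> b.
  have [u [v uv]] := two_actions.
  by have [->|au] := pselect (a = u); [exists v|exists u].
have [[c Rc]|no] := pselect (exists a, R (stop [set a]) (stop set0)).
  have R0 A := R_stop R_cong bisim_R A Rc.
  move=> L L'; transitivity (stop (@set0 Act)); last symmetry;
    exact: (R_collapse R_cong bisim_R R0 _ c).
(* With no [stop [set a]] congruent to [stop set0], [R_stop1] forces congruent LTSs to have equal
   alphabets. *)
case: R_not_alphabet => L L' LL'.
have sub K K' : R K K' -> alphabet K `<=` alphabet K'.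
  move=> KK' a Ka; apply: contrapT => nK'a; apply: no; exists a.
  by have [b ab] := other a; apply: R_stop1 ab KK' Ka nK'a.
by apply/seteqP; split; apply: sub => //; symmetry.
Qed.
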